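(* Let $(X,d)$ be a compact metric space and let $T_1,\dots,T_k\colon X\to X$ ($k\ge2$) be continuous maps such that the set $S_{\mathrm t}$ of weakly hyperbolic sequences of $\mathrm{IFS}(T_1,\dots,T_k)$ is non-empty. Then $\overline{A_{\mathrm t}}$ is the minimum fixed point of the Barnsley-Hutchinson operator $\mathcal B$.
   Context: The Barnsley-Hutchinson operator of $\mathrm{IFS}(T_1,\dots,T_k)$ is $\mathcal B(A)=\bigcup_{i=1}^k T_i(A)$ for $A\subset X$. A fixed point of $\mathcal B$ means a non-empty compact set $K\subset X$ with $\mathcal B(K)=K$. A fixed point $Y$ is the minimum fixed point if $Y\subset K$ for every fixed point $K$ of $\mathcal B$. $\Sigma_k^+=\{1,\dots,k\}^{\mathbb N}$. The set of weakly hyperbolic sequences is $S_{\mathrm t}=\{\xi\in\Sigma_k^+ : \lim_{n\to\infty}\mathrm{diam}(T_{\xi_0}\circ\cdots\circ T_{\xi_n}(X))=0\}$. The coding map $\pi\colon S_{\mathrm t}\to X$ is $\pi(\xi)=\lim_{n\to\infty}T_{\xi_0}\circ\cdots\circ T_{\xi_n}(p)$, which does not depend on $p\in X$. The target set is $A_{\mathrm t}=\pi(S_{\mathrm t})$. *)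

(* Defs.v *)
From HB Require Import structures.
From mathcomp Require Import all_boot all_order all_algebra.
From mathcomp Require Import all_classical all_reals all_analysis.

Set Implicit Arguments.
Unset Strict Implicit.
Unset Printing Implicit Defensive.

Local Open Scope classical_set_scope.
Local Open Scope ring_scope.

(* Nonempty metric spaces: [lim] needs a pointed carrier, and fixed points of
   the Barnsley-Hutchinson operator are non-empty subsets of the space. *)
#[short(type="pmetricType")]
HB.structure Definition PointedMetric (R : numDomainType) :=
  {M of Pointed M & Metric R M}.

(* The value on the empty set is -oo, but only non-empty sets arise below. *)
Definition diam (R : realType) (X : metricType R) (A : set X) : \bar R :=
  ereal_sup [set (mdist x y)%:E | x in A & y in A].

Section IFS.
Context (R : realType) (X : pmetricType R) (k : nat) (T : 'I_k -> X -> X).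

Definition barnsley_hutchinson (A : set X) : set X := \bigcup_i (T i @` A).

Definition is_fixed_point (K : set X) : Prop :=
  [/\ K !=set0, compact K & barnsley_hutchinson K = K].

Definition is_minimum_fixed_point (Y : set X) : Prop :=
  is_fixed_point Y /\ forall K, is_fixed_point K -> Y `<=` K.

(* T_{xi 0} \o ... \o T_{xi n}, which has n + 1 factors *)
Fixpoint prefix_comp (xi : nat -> 'I_k) (n : nat) : X -> X :=
  match n with
  | 0 => T (xi 0)
  | m.+1 => prefix_comp xi m \o T (xi m.+1)
  end.

Definition weakly_hyperbolic : set (nat -> 'I_k) :=
  [set xi | diam (range (prefix_comp xi n)) @[n --> \oo] --> 0%E].

(* On weakly hyperbolic sequences over a compact space the limit exists and
   does not depend on [p]; elsewhere the value is irrelevant. *)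
Definition coding_map (p : X) (xi : nat -> 'I_k) : X :=
  lim (prefix_comp xi n p @[n --> \oo]).

Definition target_set (p : X) : set X := coding_map p @` weakly_hyperbolic.

End IFS.

(* Main.v *)
Require Import Defs.
From mathcomp Require Import all_boot all_order all_algebra.
From mathcomp Require Import all_classical all_reals all_analysis.

(** Write [P_n] for the composition [T_{xi 0} \o ... \o T_{xi n}]. The ranges
    of the [P_n] decrease with [n], so over a compact space a sequence [xi] is
    weakly hyperbolic exactly when these ranges shrink to a single point [c],
    and then [c] is the value of the coding map at [xi], whatever the base
    point. Hence [A_t] is the set of all points to which some sequence shrinks
    ([target_set_sub_closed] and [target_set_invariant] both rest on this
    description, [target_setE]).

    Prepending a letter [i] to a sequence that shrinks to [c] gives, by
    continuity, a sequence that shrinks to [T_i c]. So [A_t], and by continuity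
    its closure, is mapped into itself by every [T_i].

    Conversely, let [A] be any non-empty set mapped into itself by all the
    [T_i], and take [a] in [A]. All points [P_n a] lie in [T_{xi 0}(A)], hence
    in [B(A)], and they converge to the value coded by [xi]. So every closed set
    that contains [B(A)] contains [A_t] ([target_set_sub_closed]). This is used
    twice. With [A = A_t] and the closed set [B(closure A_t)] it gives the
    remaining inclusion for [closure A_t] to be a fixed point; removing the
    first letter of [xi] instead would not work, since the shifted sequence may
    fail to be weakly hyperbolic, for instance when [T_{xi 0}] is constant.
    With [A = K = B(K)] a fixed point it gives minimality. *)

Set Implicit Arguments.
Unset Strict Implicit.
Unset Printing Implicit Defensive.

Import Order.TTheory GRing.Theory Num.Theory metricType_numDomainType.

Local Open Scope classical_set_scope.

Lemma mdist_le_diam (R : realType) (X : metricType R) (A : set X) (x y : X) :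
  A x -> A y -> ((mdist x y)%:E <= diam A)%E.
Proof. by move=> Ax Ay; apply: ereal_sup_ubound; exists x => //; exists y. Qed.

Lemma diam_le (R : realType) (X : metricType R) (A : set X) (e : R) :
  (forall x y, A x -> A y -> (mdist x y <= e)%R) -> (diam A <= e%:E)%E.
Proof.
move=> Ae; apply: ge_ereal_sup => _ [x Ax [y Ay <-]].
by rewrite lee_fin; exact: Ae.
Qed.

Lemma cvg_diam0P (R : realType) (X : pmetricType R) (A : nat -> set X) :
  (forall n, A n !=set0) ->
  diam (A n) @[n --> \oo] --> 0%E <->
  forall e : R, (0 < e)%R ->
    \forall n \near \oo, forall x y, A n x -> A n y -> (mdist x y < e)%R.
Proof.
move=> A0; split=> [dA e e0|dA U [e /= e0 eU]].
- have /dA : nbhs (0%E : \bar R) [set z | (z < e%:E)%E].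
    by apply: open_nbhs_nbhs; split; [exact: open_ereal_lt_ereal|rewrite /= lte_fin].
  apply: (@filterS _ \oo) => n /= dAe x y Ax Ay.
  by rewrite -lte_fin (le_lt_trans _ dAe)// mdist_le_diam.
- have e20 : (0 < e / 2)%R by rewrite divr_gt0.
  apply: (@filterS _ \oo) (dA _ e20) => n dAn.
  have dle : (diam (A n) <= (e / 2)%:E)%E.
    by apply: diam_le => x y Ax Ay; rewrite ltW// dAn.
  have [x Ax] := A0 n.
  have dge : (0 <= diam (A n))%E.
    by rewrite (le_trans _ (mdist_le_diam Ax Ax))// lee_fin mdist_ge0.
  have dfin : diam (A n) \is a fin_num.
    by rewrite ge0_fin_numE// (le_lt_trans dle)// ltry.
  move: dle dge; rewrite /= -(fineK dfin) !lee_fin => dle dge.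
  apply: eU => /=; rewrite sub0r normrN ger0_norm//.
  by rewrite (le_lt_trans dle)// ltr_pdivrMr// ltr_pMr// ltr1n.
Qed.

Section IFS.
Context {R : realType} {X : pmetricType R} {k : nat} (T : 'I_k -> X -> X).

(** Uniform convergence of the [P_n] to the constant [c], phrased with
    neighbourhoods so that continuity of the maps applies directly. *)
Definition shrinks_to (xi : nat -> 'I_k) (c : X) : Prop :=
  forall U, nbhs c U ->
    \forall n \near \oo, range (prefix_comp T xi n) `<=` U.

Definition prepend (i : 'I_k) (xi : nat -> 'I_k) (n : nat) : 'I_k :=
  if n is m.+1 then xi m else i.

Lemma prefix_comp_prepend i xi n :
  prefix_comp T (prepend i xi) n.+1 = T i \o prefix_comp T xi n.
Proof. by elim: n => [//|n IH]; rewrite -[LHS]/(prefix_comp T (prepend i xi) n.+1 \o _) IH. Qed.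

Lemma range_prefix_comp_le xi m n : (m <= n)%N ->
  range (prefix_comp T xi n) `<=` range (prefix_comp T xi m).
Proof.
elim: n => [|n IH]; first by rewrite leqn0 => /eqP ->.
rewrite leq_eqVlt => /predU1P[-> //|/IH sub] _ [x _ <-].
by apply: sub; exists (T (xi n.+1) x).
Qed.

(** Only the outermost letter of [P_n] is kept track of: the inner maps move a
    point of [A] within [A]. *)
Lemma prefix_comp_image xi n (A : set X) :
  (forall i, T i @` A `<=` A) ->
  forall a, A a -> (T (xi 0%N) @` A) (prefix_comp T xi n a).
Proof.
move=> TA; elim: n => [|n IH] a Aa /=; first by exists a.
by apply: IH; apply: (TA (xi n.+1)); exists a.
Qed.

Lemma shrinks_to_weakly_hyperbolic xi c :
  shrinks_to xi c -> weakly_hyperbolic T xi.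
Proof.
move=> xic; apply/cvg_diam0P; first by move=> n; exists (prefix_comp T xi n c), c.
move=> e e0; have e20 : (0 < e / 2)%R by rewrite divr_gt0.
have := xic _ (nbhsx_ballx c (e / 2)%R e20).
apply: (@filterS _ \oo) => n sub x y /sub + /sub.
rewrite /= !ballEmdist/= => cx cy.
rewrite (le_lt_trans (metric_triangle _ c _))// [ltRHS]splitr ltrD//.
by rewrite metric_sym.
Qed.

(** Compactness gives a cluster point [c] of the orbit of one point under the
    [P_n]. As the ranges are nested, one small range that comes close to [c]
    forces all later ones to be close to [c]. *)
Lemma weakly_hyperbolic_shrinks_to xi : compact [set: X] ->
  weakly_hyperbolic T xi -> exists c, shrinks_to xi c.
Proof.
move=> cX /cvg_diam0P xiP.
(* The carrier is pointed, so the ranges are non-empty. *)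
have {}xiP := xiP (fun n => ex_intro _ _ (ex_intro2 _ _ point I erefl)).
have [c [_ clc]] := cX ((fun n => prefix_comp T xi n point) @ \oo) _ filterT.
exists c => U; rewrite -filter_from_mdist_nbhs => -[e /= e0 eU].
have e20 : (0 < e / 2)%R by rewrite divr_gt0.
have [N _ small] := xiP _ e20.
have tail : \forall n \near \oo, range (prefix_comp T xi N) (prefix_comp T xi n point).
  exists N => // n /= Nn; apply: (range_prefix_comp_le Nn).
  by exists point.
have [y [Ny cy]] := clc _ _ tail (nbhsx_ballx c (e / 2)%R e20).
exists N => // n /= Nn x /(range_prefix_comp_le Nn) Nx; apply: eU.
move: cy; rewrite ballEmdist/= => cy.
rewrite (le_lt_trans (metric_triangle _ y _))// [ltRHS]splitr ltrD//.
exact: (small N (leqnn N)).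
Qed.

Lemma shrinks_to_cvg xi c p :
  shrinks_to xi c -> prefix_comp T xi n p @[n --> \oo] --> c.
Proof. by move=> xic U /xic; apply: filterS => n; apply; exists p. Qed.

Lemma coding_mapE p xi c : shrinks_to xi c -> coding_map T p xi = c.
Proof. by move=> xic; apply: cvg_lim; [exact: metric_hausdorff|exact: shrinks_to_cvg]. Qed.

Lemma target_setE p : compact [set: X] ->
  target_set T p = [set c | exists xi, shrinks_to xi c].
Proof.
move=> cX; apply/seteqP; split=> [_ [xi wh <-]|c [xi xic]] /=.
  have [c xic] := weakly_hyperbolic_shrinks_to cX wh.
  by exists xi; rewrite (coding_mapE p xic).
by exists xi; [exact: shrinks_to_weakly_hyperbolic xic|exact: coding_mapE].
Qed.

Lemma shrinks_to_prepend i xi c : continuous (T i) ->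
  shrinks_to xi c -> shrinks_to (prepend i xi) (T i c).
Proof.
move=> Ti xic U /Ti /xic [N _ sub]; exists N.+1 => // -[//|n] Nn.
by rewrite /mkset prefix_comp_prepend => _ [x _ <-]; apply: (sub n) => //; exists x.
Qed.

Lemma target_set_invariant p i : compact [set: X] -> continuous (T i) ->
  T i @` target_set T p `<=` target_set T p.
Proof.
move=> cX Ti; rewrite target_setE// => _ [c [xi xic] <-].
by exists (prepend i xi); exact: shrinks_to_prepend.
Qed.

(** Every coded point is the limit of the images [P_n a] of a point [a] of [A],
    and all of these lie in [T_{xi 0}(A)]. *)
Lemma target_set_sub_closed p (A F : set X) : compact [set: X] ->
  A !=set0 -> (forall i, T i @` A `<=` A) -> closed F ->
  barnsley_hutchinson T A `<=` F -> target_set T p `<=` F.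
Proof.
move=> cX [a Aa] TA cF AF; rewrite target_setE// => c [xi xic].
apply: (closed_cvg _ cF _ _ (shrinks_to_cvg a xic)).
apply: nearW => n; apply: AF; exists (xi 0%N) => //.
exact: prefix_comp_image.
Qed.

Lemma closed_barnsley_hutchinson (A : set X) : compact [set: X] ->
  (forall i, continuous (T i)) -> closed A -> closed (barnsley_hutchinson T A).
Proof.
move=> cX cT cA; apply: closed_bigcup => [|i _]; first exact: finite_finset.
apply: compact_closed; first exact: metric_hausdorff.
apply: continuous_compact; first exact: continuous_subspaceT.
exact: (subclosed_compact cA cX).
Qed.

End IFS.

Theorem proposition3p5 (R : realType) (X : pmetricType R) (k : nat)
    (T : 'I_k -> X -> X) (k_ge2 : (2 <= k)%N)
    (compactX : compact [set: X])
    (continuousT : forall i : 'I_k, continuous (T i))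
    (weakly_hyperbolic_nonempty : weakly_hyperbolic T !=set0) :
  forall p : X, is_minimum_fixed_point T (closure (target_set T p)).
Proof.
move=> p; set A := target_set T p.
have A0 : A !=set0.
  by have [xi wh] := weakly_hyperbolic_nonempty; exists (coding_map T p xi), xi.
have TA i : T i @` A `<=` A by exact: target_set_invariant.
have clA : closed (closure A) by exact: closed_closure.
split; first split.
- by have [c Ac] := A0; exists c; exact: subset_closure.
- exact: (subclosed_compact clA compactX).
- apply/seteqP; split=> [_ [i _ [x clx <-]]|].
  + have clTA : closed (T i @^-1` closure A).
      by move/continuous_closedP: (continuousT i); apply.
    suff sub : closure A `<=` T i @^-1` closure A by exact: sub.
    rewrite [X in _ `<=` X](iffLR (closure_id _) clTA); apply: closureS => a Aa.
    by apply: subset_closure; apply: (TA i); exists a.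
  + have cB := closed_barnsley_hutchinson compactX continuousT clA.
    rewrite [X in _ `<=` X](iffLR (closure_id _) cB); apply: closureS.
    apply: (target_set_sub_closed compactX A0 TA cB).
    by move=> _ [i _ [x Ax <-]]; exists i => //; exists x => //; exact: subset_closure.
- move=> K [K0 cK BK].
  have clK : closed K by apply: compact_closed => //; exact: metric_hausdorff.
  rewrite [X in _ `<=` X](iffLR (closure_id _) clK); apply: closureS.
  apply: (target_set_sub_closed compactX K0 _ clK); last by rewrite BK.
  by move=> i _ [x Kx <-]; rewrite -BK; exists i => //; exists x.
Qed.
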